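(* Let $\Lambda=KQ/I$ be an arbitrary path algebra modulo relations, and let $e$ be the sum of the primitive idempotents corresponding to the precyclic vertices of $Q$. If $\mathcal{P}^{<\infty}(e\Lambda e\text{-mod})$ is contravariantly finite in $e\Lambda e\text{-mod}$, e.g., if $\operatorname{l.findim}e\Lambda e=0$, then $\mathcal{P}^{<\infty}(\Lambda\text{-mod})$ is contravariantly finite in $\Lambda\text{-mod}$.
   Context: A path algebra modulo relations is $\Lambda=KQ/I$ with $K$ a field, $Q$ a finite quiver and $I$ an admissible ideal of $KQ$ (so $\Lambda$ is a basic finite dimensional algebra). Paths are composed from right to left, so that $\Lambda e_i$ is spanned by the paths starting in the vertex $e_i$; vertices are identified with primitive idempotents of $\Lambda$. A vertex $e_i$ is precyclic if there is a path of length $\ge0$ which starts in $e_i$ and ends on an oriented cycle. For an Artin algebra $A$, $A\text{-mod}$ is the category of finitely generated left $A$-modules, $\mathcal{P}^{<\infty}(A\text{-mod})$ its full subcategory of modules of finite projective dimension, and $\operatorname{l.findim}A$ the supremum of the projective dimensions of objects of $\mathcal{P}^{<\infty}(A\text{-mod})$. $\mathcal{P}^{<\infty}(A\text{-mod})$ is contravariantly finite in $A\text{-mod}$ if for each $M\in A\text{-mod}$ there is a map $\phi:X\to M$ with $X\in\mathcal{P}^{<\infty}(A\text{-mod})$ through which every homomorphism from an object of $\mathcal{P}^{<\infty}(A\text{-mod})$ to $M$ factors. *)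

(* Defs.v *)
(* MathComp, with boolp for classical decidability of ideal membership.       *)
From HB Require Import structures.
From mathcomp Require Import all_boot all_order all_algebra.
From mathcomp Require Import finmap monalg.
From mathcomp Require Import boolp classical_sets.

Set Implicit Arguments.
Unset Strict Implicit.
Unset Printing Implicit Defensive.

Import GRing.Theory.
Local Open Scope ring_scope.

(* Rings and modules are taken over pzRingType throughout, because the zero   *)
(* ring does occur: e Lambda e = 0 as soon as Q has no oriented cycle.        *)

(* -------------------------------------------------------------------------- *)
Section Modules.
Context (A : pzRingType).
Implicit Types M N P X Y : lmodType A.

Definition surjective_map (U V : Type) (f : U -> V) : Prop :=
  forall y, exists x, f x = y.

Definition finitely_generated M : Prop :=
  exists (n : nat) (b : 'I_n -> M),
    forall x, exists c : 'I_n -> A, x = \sum_(i < n) c i *: b i.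

Definition projective P : Prop :=
  forall (M N : lmodType A) (g : {linear M -> N}) (f : {linear P -> N}),
    surjective_map g ->
    exists h : {linear P -> M}, forall x, g (h x) = f x.

(* pd M <= n: an exact sequence 0 -> P_n -> ... -> P_0 -> M -> 0 with all P_i *)
(* projective, written as an infinite resolution with P_i = 0 for i > n.      *)
Definition projdim_le M (n : nat) : Prop :=
  exists (P : nat -> lmodType A) (d : forall i, {linear P i.+1 -> P i})
         (eps : {linear P 0%N -> M}),
    [/\ forall i, projective (P i),
        surjective_map eps,
        forall x, eps x = 0 <-> exists y, d 0%N y = x,
        forall i x, d i x = 0 <-> exists y, d i.+1 y = x
      & forall i, (n < i)%N -> forall x : P i, x = 0].

(* The objects of P^{<oo}(A-mod). *)
Definition fin_projdim M : Prop :=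
  finitely_generated M /\ exists n, projdim_le M n.

(* l.findim A = d for a natural number d, with the convention pd 0 = 0. *)
Definition is_lfindim (d : nat) : Prop :=
  (forall M, fin_projdim M -> projdim_le M d) /\
  (forall d', (forall M, fin_projdim M -> projdim_le M d') -> (d <= d')%N).

(* C is a full subcategory of A-mod, given by its class of objects. *)
Definition contravariantly_finite (C : lmodType A -> Prop) : Prop :=
  forall M, finitely_generated M ->
    exists (X : lmodType A) (phi : {linear X -> M}),
      C X /\
      forall Y (f : {linear Y -> M}), C Y ->
        exists g : {linear Y -> X}, forall y, f y = phi (g y).

End Modules.

Arguments fin_projdim : clear implicits.
Arguments is_lfindim : clear implicits.

(* -------------------------------------------------------------------------- *)
Section Ideals.
Local Open Scope classical_set_scope.
Context (R : pzRingType).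

Definition two_sided_ideal (I : set R) : Prop :=
  [/\ I 0,
      forall x y, I x -> I y -> I (x + y),
      forall a x, I x -> I (a * x)
    & forall a x, I x -> I (x * a)].

Definition ideal_gen (S : set R) : set R :=
  [set x | forall I, two_sided_ideal I -> S `<=` I -> I x].

Definition ideal_mul (I J : set R) : set R :=
  ideal_gen [set x * y | x in I & y in J].

Definition ideal_exp (I : set R) (n : nat) : set R :=
  iter n (ideal_mul I) setT.

Record ideal := Ideal {
  ideal_set : set R;
  idealP : two_sided_ideal ideal_set
}.

End Ideals.

Section QuotientRing.
Context (R : pzRingType) (I : ideal R).
Local Open Scope quotient_scope.

Definition ideal_pred : {pred R} := fun x => `[< ideal_set I x >].

Lemma ideal_predP x : reflect (ideal_set I x) (x \in ideal_pred).
Proof. exact: asboolP. Qed.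

Lemma ideal_pred_zmod_closed : zmod_closed ideal_pred.
Proof.
have [I0 ID IMl _] := idealP I.
split; first exact/ideal_predP.
move=> x y /ideal_predP Ix /ideal_predP Iy; apply/ideal_predP.
by apply: ID => //; rewrite -mulN1r; exact: IMl.
Qed.

HB.instance Definition _ :=
  GRing.isZmodClosed.Build R ideal_pred ideal_pred_zmod_closed.

(* ring_quotient only provides the multiplication for commutative R. *)
Definition quot_ring := Quotient.quot (ideal_pred : zmodClosed R).

HB.instance Definition _ := GRing.Zmodule.on quot_ring.
HB.instance Definition _ := EqQuotient.on quot_ring.

Definition quot_proj (x : R) : quot_ring := \pi_quot_ring x.
Definition quot_one : quot_ring := quot_proj 1.
Definition quot_mul (x y : quot_ring) : quot_ring :=
  quot_proj (repr x * repr y).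

Lemma quot_projE x y : quot_proj x = quot_proj y <-> ideal_set I (x - y).
Proof.
rewrite /quot_proj; split.
  by move=> /eqP; rewrite eqmodE /= Quotient.equivE => /ideal_predP.
move=> h; apply/eqP; rewrite eqmodE /= Quotient.equivE.
exact/ideal_predP.
Qed.

Lemma quot_projK x : quot_proj (repr x) = x.
Proof. exact: reprK. Qed.

Lemma quot_projD : {morph quot_proj : x y / x + y}.
Proof. exact: Quotient.pi_add. Qed.

Lemma quot_projM x y : quot_proj (x * y) = quot_mul (quot_proj x) (quot_proj y).
Proof.
have [_ ID IMl IMr] := idealP I.
apply/quot_projE; set x' := repr _; set y' := repr _.
have Ix : ideal_set I (x - x') by apply/quot_projE; rewrite quot_projK.
have Iy : ideal_set I (y - y') by apply/quot_projE; rewrite quot_projK.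
have -> : x * y - x' * y' = (x - x') * y + x' * (y - y').
  by rewrite mulrBl mulrBr addrA subrK.
by apply: ID; [exact: IMr | exact: IMl].
Qed.

Fact quot_mulA : associative quot_mul.
Proof.
move=> x y z; rewrite -[x]quot_projK -[y]quot_projK -[z]quot_projK.
by rewrite -!quot_projM mulrA.
Qed.

Fact quot_mul1q : left_id quot_one quot_mul.
Proof. by move=> x; rewrite -[x]quot_projK -quot_projM mul1r. Qed.

Fact quot_mulq1 : right_id quot_one quot_mul.
Proof. by move=> x; rewrite -[x]quot_projK -quot_projM mulr1. Qed.

Fact quot_mulDl : left_distributive quot_mul +%R.
Proof.
move=> x y z; rewrite -[x]quot_projK -[y]quot_projK -[z]quot_projK.
by rewrite -quot_projD -!quot_projM -quot_projD mulrDl.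
Qed.

Fact quot_mulDr : right_distributive quot_mul +%R.
Proof.
move=> x y z; rewrite -[x]quot_projK -[y]quot_projK -[z]quot_projK.
by rewrite -quot_projD -!quot_projM -quot_projD mulrDr.
Qed.

HB.instance Definition _ := GRing.Zmodule_isPzRing.Build quot_ring
  quot_mulA quot_mul1q quot_mulq1 quot_mulDl quot_mulDr.

End QuotientRing.

(* -------------------------------------------------------------------------- *)
(* The corner ring eRe with unit e. As e is idempotent, x lies in eRe if and  *)
(* only if exe = x.                                                           *)
Section Corner.
Context (R : pzRingType) (e : R).

Definition corner_pred : {pred R} := fun x => e * x * e == x.

Lemma corner_pred_zmod_closed : zmod_closed corner_pred.
Proof.
split; first by rewrite /in_mem /= /corner_pred mulr0 mul0r.
move=> x y; rewrite /in_mem /= /corner_pred => /eqP ex /eqP ey.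
by rewrite mulrBr mulrBl ex ey.
Qed.

HB.instance Definition _ :=
  GRing.isZmodClosed.Build R corner_pred corner_pred_zmod_closed.

Record corner (he : e * e = e) := Corner {
  corner_val : R;
  corner_valP : corner_val \in corner_pred
}.

Context (he : e * e = e).

HB.instance Definition _ := [isSub for @corner_val he].
HB.instance Definition _ := [Choice of corner he by <:].
HB.instance Definition _ := [SubChoice_isSubZmodule of corner he by <:].

Lemma corner_valK (x : corner he) : e * val x * e = val x.
Proof. exact/eqP/corner_valP. Qed.

Lemma corner_mull (x : corner he) : e * val x = val x.
Proof. by rewrite -[val x]corner_valK !mulrA he. Qed.

Lemma corner_mulr (x : corner he) : val x * e = val x.
Proof. by rewrite -[val x]corner_valK -!mulrA he. Qed.

Fact corner_one_subproof : e \in corner_pred.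
Proof. by rewrite /in_mem /= /corner_pred !he. Qed.

Fact corner_mul_subproof (x y : corner he) : val x * val y \in corner_pred.
Proof.
by rewrite /in_mem /= /corner_pred mulrA corner_mull -mulrA corner_mulr.
Qed.

Definition corner_one : corner he := Corner he corner_one_subproof.
Definition corner_mul (x y : corner he) : corner he :=
  Corner he (corner_mul_subproof x y).

Fact corner_mulA : associative corner_mul.
Proof. by move=> x y z; apply/val_inj; rewrite /= mulrA. Qed.

Fact corner_mul1 : left_id corner_one corner_mul.
Proof. by move=> x; apply/val_inj; rewrite /= corner_mull. Qed.

Fact corner_mulr1 : right_id corner_one corner_mul.
Proof. by move=> x; apply/val_inj; rewrite /= corner_mulr. Qed.

Fact corner_mulDl : left_distributive corner_mul +%R.
Proof. by move=> x y z; apply/val_inj; rewrite /= mulrDl. Qed.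

Fact corner_mulDr : right_distributive corner_mul +%R.
Proof. by move=> x y z; apply/val_inj; rewrite /= mulrDr. Qed.

HB.instance Definition _ := GRing.Zmodule_isPzRing.Build (corner he)
  corner_mulA corner_mul1 corner_mulr1 corner_mulDl corner_mulDr.

End Corner.

(* -------------------------------------------------------------------------- *)
Record quiver := Quiver {
  vertex : finType;
  arrow : finType;
  asource : arrow -> vertex;
  atarget : arrow -> vertex
}.

Section Paths.
Context (Q : quiver).
Implicit Types (v : vertex Q) (s : seq (arrow Q)).

(* The arrows s can be traversed in order, first arrow first, starting in v.  *)
Fixpoint walk v s : bool :=
  if s is a :: s' then (asource a == v) && walk (atarget a) s' else true.

Definition walk_end v s : vertex Q := last v (map (@atarget Q) s).

(* A path, as its starting vertex and its arrows in order of traversal. *)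
Record qpath := QPath {
  qpath_val : vertex Q * seq (arrow Q);
  qpath_valP : walk qpath_val.1 qpath_val.2
}.

HB.instance Definition _ := [isSub for qpath_val].
HB.instance Definition _ := [Choice of qpath by <:].

Implicit Types p q : qpath.

Definition psource p : vertex Q := (val p).1.
Definition parrows p : seq (arrow Q) := (val p).2.
Definition plength p : nat := size (parrows p).
Definition ptarget p : vertex Q := walk_end (psource p) (parrows p).

Definition trivial_path v : qpath := @QPath (v, [::]) isT.

Fact arrow_path_subproof (a : arrow Q) : walk (asource a) [:: a].
Proof. by rewrite /= eqxx. Qed.

Definition arrow_path (a : arrow Q) : qpath :=
  @QPath (asource a, [:: a]) (arrow_path_subproof a).

(* Composition from right to left: p * q is "first q, then p", and is         *)
(* undefined unless q ends where p starts.                                    *)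
Definition pcomp p q : option qpath :=
  if ptarget q == psource p then insub (psource q, parrows q ++ parrows p)
  else None.

Lemma walk_cat v s1 s2 :
  walk v (s1 ++ s2) = walk v s1 && walk (walk_end v s1) s2.
Proof. by elim: s1 v => //= a s1 IH v; rewrite IH andbA. Qed.

Lemma walk_end_cat v s1 s2 :
  walk_end v (s1 ++ s2) = walk_end (walk_end v s1) s2.
Proof. by rewrite /walk_end map_cat last_cat. Qed.

Lemma pcompP p q :
  if pcomp p q is Some r then
    [/\ ptarget q = psource p, psource r = psource q
      & parrows r = parrows q ++ parrows p]
  else ptarget q != psource p.
Proof.
rewrite /pcomp; case: eqP => //= qp; case: insubP => [r _ rE|] /=.
  by rewrite /psource /parrows rE.
move/negP; case; rewrite walk_cat (valP q) /=.
by move: qp; rewrite /ptarget => ->; exact: (valP p).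
Qed.

Lemma pcomp_target p q r : pcomp p q = Some r -> ptarget r = ptarget p.
Proof.
move=> e; have := pcompP p q; rewrite e => -[qp rq rE].
by rewrite /ptarget rE rq walk_end_cat -/(ptarget q) qp.
Qed.

Lemma pcompA p q r :
  obind (pcomp p) (pcomp q r) = obind (fun x => pcomp x r) (pcomp p q).
Proof.
have h1 := pcompP q r; have h2 := pcompP p q.
case e1: (pcomp q r) h1 => [x|] h1; case e2: (pcomp p q) h2 => [y|] h2 //=.
- have [rq sx ax] := h1; have [qp sy ay] := h2.
  rewrite /pcomp (pcomp_target e1) qp eqxx sy rq eqxx sx ax ay catA.
  by [].
- have := pcompP p x; case: pcomp => // z [].
  by rewrite (pcomp_target e1) => qp; rewrite qp eqxx in h2.
- have := pcompP y r; case: pcomp => // z [].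
  by have [_ -> _] := h2 => rq; rewrite rq eqxx in h1.
Qed.

Lemma pcomp1p v p :
  pcomp (trivial_path v) p = if ptarget p == v then Some p else None.
Proof.
have := pcompP (trivial_path v) p; case: pcomp => [r|/negPf -> //].
case=> pv sr ar; rewrite pv eqxx; congr Some; apply/val_inj.
by rewrite [LHS]surjective_pairing [RHS]surjective_pairing; congr pair;
  rewrite -/(parrows r) -/(parrows p) ?ar ?cats0.
Qed.

Lemma pcompp1 v p :
  pcomp p (trivial_path v) = if v == psource p then Some p else None.
Proof.
have := pcompP p (trivial_path v); case: pcomp => [r|/negPf -> //].
case=> pv sr ar; rewrite -pv eqxx; congr Some; apply/val_inj.
rewrite [LHS]surjective_pairing [RHS]surjective_pairing; congr pair.
- by rewrite -/(psource r) -/(psource p) sr -pv.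
- by rewrite -/(parrows r) -/(parrows p) ar.
Qed.

Definition on_oriented_cycle v : Prop :=
  exists c : qpath, [/\ (0 < plength c)%N, psource c = v & ptarget c = v].

Definition precyclic v : Prop :=
  exists p : qpath, psource p = v /\ on_oriented_cycle (ptarget p).

End Paths.

(* -------------------------------------------------------------------------- *)
(* KQ: finitely supported functions on the paths of Q, with << c *g p >> the  *)
(* multiple c p of the path p and x@_p the coefficient of p in x.             *)
Definition path_alg (K : fieldType) (Q : quiver) := {malg K[qpath Q]}.

Section PathAlgebra.
Local Open Scope fset_scope.
Local Open Scope ring_scope.
Context (K : fieldType) (Q : quiver).
Implicit Types (x y z : path_alg K Q) (p q : qpath Q) (v : vertex Q).

HB.instance Definition _ := GRing.Lmodule.on (path_alg K Q).

Definition opath (c : K) (o : option (qpath Q)) : path_alg K Q :=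
  if o is Some p then << c *g p >> else 0.

Lemma opath0 o : opath 0 o = 0.
Proof. by case: o => //= p; rewrite monalgU0. Qed.

Lemma opathD c d o : opath (c + d) o = opath c o + opath d o.
Proof. by case: o => [p|] /=; rewrite ?monalgUD ?addr0. Qed.

Definition pa_one : path_alg K Q := \sum_(v : vertex Q) << trivial_path v >>.

Definition pa_mul x y : path_alg K Q :=
  \sum_(p <- msupp x) \sum_(q <- msupp y) opath (x@_p * y@_q) (pcomp p q).

Lemma pa_mulw (d1 d2 : {fset qpath Q}) x y :
  msupp x `<=` d1 -> msupp y `<=` d2 ->
  pa_mul x y = \sum_(p <- d1) \sum_(q <- d2) opath (x@_p * y@_q) (pcomp p q).
Proof.
move=> le1 le2; rewrite /pa_mul (big_fset_incl _ le1) /=.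
  apply/eq_bigr=> p _; apply/big_fset_incl => // q _ /mcoeff_outdom ->.
  by rewrite mulr0 opath0.
move=> p _ /mcoeff_outdom xp.
by rewrite big1 // => q _; rewrite xp mul0r opath0.
Qed.

Lemma pa_mul0x : left_zero 0 pa_mul.
Proof. by move=> x; rewrite /pa_mul msupp0 big_seq_fset0. Qed.

Lemma pa_mulx0 : right_zero 0 pa_mul.
Proof.
by move=> x; rewrite /pa_mul big1 // => p _; rewrite msupp0 big_seq_fset0.
Qed.

Lemma pa_mulDl : left_distributive pa_mul +%R.
Proof.
move=> x y z; rewrite (pa_mulw (msuppD_le x y) (fsubset_refl (msupp z))).
rewrite (pa_mulw (fsubsetUl _ (msupp y)) (fsubset_refl (msupp z))).
rewrite (pa_mulw (fsubsetUr (msupp x) _) (fsubset_refl (msupp z))).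
rewrite -big_split /=; apply/eq_bigr=> p _.
rewrite -big_split /=; apply/eq_bigr=> q _.
by rewrite mcoeffD mulrDl opathD.
Qed.

Lemma pa_mulDr : right_distributive pa_mul +%R.
Proof.
move=> x y z; rewrite (pa_mulw (fsubset_refl (msupp x)) (msuppD_le y z)).
rewrite (pa_mulw (fsubset_refl (msupp x)) (fsubsetUl _ (msupp z))).
rewrite (pa_mulw (fsubset_refl (msupp x)) (fsubsetUr (msupp y) _)).
rewrite -big_split /=; apply/eq_bigr=> p _.
rewrite -big_split /=; apply/eq_bigr=> q _.
by rewrite mcoeffD mulrDr opathD.
Qed.

Lemma pa_mulUU c d p q :
  pa_mul << c *g p >> << d *g q >> = opath (c * d) (pcomp p q).
Proof. by rewrite (pa_mulw msuppU_le msuppU_le) !big_seq_fset1 !mcoeffUU. Qed.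

Lemma pa_mul_suml (T : Type) (r : seq T) (F : T -> path_alg K Q) y :
  pa_mul (\sum_(i <- r) F i) y = \sum_(i <- r) pa_mul (F i) y.
Proof.
exact: (big_morph (pa_mul^~ y) (fun a b => pa_mulDl a b y) (pa_mul0x y)).
Qed.

Lemma pa_mul_sumr (T : Type) (r : seq T) (F : T -> path_alg K Q) x :
  pa_mul x (\sum_(i <- r) F i) = \sum_(i <- r) pa_mul x (F i).
Proof. exact: (big_morph (pa_mul x) (pa_mulDr x) (pa_mulx0 x)). Qed.

Lemma pa_mulA : associative pa_mul.
Proof.
have UUU c d b p q r : pa_mul << c *g p >> (pa_mul << d *g q >> << b *g r >>) =
                       pa_mul (pa_mul << c *g p >> << d *g q >>) << b *g r >>.
  rewrite !pa_mulUU; have := pcompA p q r.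
  case: (pcomp q r) => [u|] /=; case: (pcomp p q) => [w|] /=;
    rewrite ?pa_mulUU ?pa_mul0x ?pa_mulx0 // => h.
  - by rewrite h mulrA.
  - by rewrite h.
  - by rewrite -h.
have UUx c d p q z : pa_mul << c *g p >> (pa_mul << d *g q >> z) =
                     pa_mul (pa_mul << c *g p >> << d *g q >>) z.
  rewrite [z]monalgE !(pa_mul_sumr (msupp z)).
  by apply/eq_bigr=> r _; exact: UUU.
have Uxx c p y z : pa_mul << c *g p >> (pa_mul y z) =
                   pa_mul (pa_mul << c *g p >> y) z.
  rewrite [y]monalgE (pa_mul_suml (msupp y)) !(pa_mul_sumr (msupp y)).
  by rewrite (pa_mul_suml (msupp y)); apply/eq_bigr=> q _; exact: UUx.
move=> x y z; rewrite [x]monalgE !(pa_mul_suml (msupp x)).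
by apply/eq_bigr=> p _; exact: Uxx.
Qed.

Lemma pa_mul1x : left_id pa_one pa_mul.
Proof.
move=> x; rewrite {2}[x]monalgE [x in LHS]monalgE pa_mul_sumr.
apply/eq_bigr=> p _; rewrite pa_mul_suml (bigD1 (ptarget p)) //=.
rewrite pa_mulUU pcomp1p eqxx /= mul1r big1 ?addr0 // => v /negPf vp.
by rewrite pa_mulUU pcomp1p eq_sym vp.
Qed.

Lemma pa_mulx1 : right_id pa_one pa_mul.
Proof.
move=> x; rewrite {2}[x]monalgE [x in LHS]monalgE pa_mul_suml.
apply/eq_bigr=> p _; rewrite pa_mul_sumr (bigD1 (psource p)) //=.
rewrite pa_mulUU pcompp1 eqxx /= mulr1 big1 ?addr0 // => v /negPf vp.
by rewrite pa_mulUU pcompp1 vp.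
Qed.

HB.instance Definition _ := GRing.Zmodule_isPzRing.Build (path_alg K Q)
  pa_mulA pa_mul1x pa_mulx1 pa_mulDl pa_mulDr.

Definition vertex_elt v : path_alg K Q := << trivial_path v >>.
Definition arrow_elt (a : arrow Q) : path_alg K Q := << arrow_path a >>.

Lemma vertex_elt_mul u v :
  vertex_elt u * vertex_elt v = if u == v then vertex_elt u else 0.
Proof.
rewrite [LHS]pa_mulUU pcomp1p mulr1 eq_sym.
by rewrite [ptarget _]/=; case: eqP => [->|].
Qed.

Definition arrow_ideal : set (path_alg K Q) := ideal_gen (range arrow_elt).

Definition admissible (I : set (path_alg K Q)) : Prop :=
  (I `<=` ideal_exp arrow_ideal 2)%classic /\
  exists2 m, (2 <= m)%N & (ideal_exp arrow_ideal m `<=` I)%classic.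

End PathAlgebra.

(* -------------------------------------------------------------------------- *)
Section PrecyclicIdempotent.
Context (K : fieldType) (Q : quiver) (I : ideal (path_alg K Q)).

Definition precyclic_sum : path_alg K Q :=
  \sum_(v : vertex Q | `[< precyclic v >]) vertex_elt K v.

Definition precyclic_idem : quot_ring I := quot_proj I precyclic_sum.

Lemma precyclic_sum_idem : precyclic_sum * precyclic_sum = precyclic_sum.
Proof.
rewrite /precyclic_sum mulr_suml; apply/eq_bigr=> v pv.
rewrite mulr_sumr (bigD1 v) //= vertex_elt_mul eqxx big1 ?addr0 // => w.
by case/andP=> _ /negPf wv; rewrite vertex_elt_mul eq_sym wv.
Qed.

Lemma precyclic_idemP : precyclic_idem * precyclic_idem = precyclic_idem.
Proof.
by rewrite /precyclic_idem -[LHS]quot_projM precyclic_sum_idem.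
Qed.

End PrecyclicIdempotent.

(* Main.v *)
(* Put f = 1 - e. Paths that start in a non-precyclic vertex never reach a    *)
(* precyclic one, so e Lambda f = 0, and eLe-modules become Lambda-modules    *)
(* through the ring morphism a |-> ea. The non-precyclic vertices span no     *)
(* oriented cycle, so Lambda-modules annihilated by e have finite projective  *)
(* dimension. It follows that a finitely generated M lies in                  *)
(* P^{<oo}(Lambda-mod) if and only if eM lies in P^{<oo}(eLe-mod). Given an   *)
(* approximation X -> eM, the pullback of X -> eM <- M, whose corner is X,    *)
(* then approximates M.                                                       *)
From HB Require Import structures.
Require Import Defs.
From mathcomp Require Import all_boot all_algebra.
From mathcomp Require Import finmap monalg boolp.

Set Implicit Arguments.
Unset Strict Implicit.
Unset Printing Implicit Defensive.

Import GRing.Theory.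
Local Open Scope ring_scope.

(** * Projective dimension by syzygies *)

(** The non-precyclic vertices are closed under successors, so e Lambda (1 - e) = 0 and a |-> ea is
    a ring morphism from Lambda to B = eLe. Inflation along it is exact and right adjoint to the
    exact functor M |-> eM. Hence cutting preserves projectives ([cut_projective]) and does not
    raise projective dimension ([cut_pd_le]).

    The substance is the converse: a finitely generated M has finite projective dimension as soon as
    eM has. It rests on [fpd_of_cover], which maps a projective onto M with kernel killed by an
    idempotent g, where the modules killed by g are already settled. For modules killed by e
    ([acyclic_fpd]) this drives an induction on a successor-closed set of vertices supporting the
    module: with no oriented cycle around, there is a source v to peel off, covered by dim e_v Z
    copies of Lambda e_v. For eM projective, an idempotent matrix over B is read over Lambda;
    Schanuel's lemma extends this to eM of any finite projective dimension ([fpd_of_cut]).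

    Finite projective dimension is thus detected on corners. Given an approximation X -> eM, the
    pullback along M -> eM has corner X, so it has finite projective dimension, and a map Z -> M
    factors through it because eZ -> eM factors through X ([corner_contravariantly_finite]). *)

Definition lin_of (A : pzRingType) (U V : lmodType A) (f : U -> V)
    (h : linear f) : {linear U -> V} :=
  HB.pack f (GRing.isLinear.Build A U V *:%R f h).

Section Kernel.
Context (A : pzRingType) (M N : lmodType A) (g : {linear M -> N}).

Definition ker_pred : {pred M} := fun x => g x == 0.

Lemma ker_pred_submod_closed : submod_closed ker_pred.
Proof.
split; first by rewrite /in_mem /= /ker_pred linear0.
move=> a x y; rewrite /in_mem /= /ker_pred => /eqP gx /eqP gy.
by rewrite linearP gx gy scaler0 addr0.
Qed.

HB.instance Definition _ :=
  GRing.isSubmodClosed.Build A M ker_pred ker_pred_submod_closed.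

Record ker_mod := KerMod { ker_val : M; ker_valP : ker_val \in ker_pred }.

HB.instance Definition _ := [isSub for ker_val].
HB.instance Definition _ := [Choice of ker_mod by <:].
HB.instance Definition _ := [SubChoice_isSubLmodule of ker_mod by <:].

Lemma ker_valE (x : ker_mod) : g (val x) = 0.
Proof. exact/eqP/ker_valP. Qed.

Definition ker_incl : {linear ker_mod -> M} := val.

Lemma in_ker (x : M) : g x = 0 -> exists y : ker_mod, ker_incl y = x.
Proof. by move=> gx; exists (KerMod (introT eqP gx)). Qed.

Section Corestriction.
Context (L : lmodType A) (f : {linear L -> M}) (gf : forall x, g (f x) = 0).

Definition ker_lift_fun (x : L) : ker_mod := KerMod (introT eqP (gf x)).

Fact ker_lift_linear : linear ker_lift_fun.
Proof. by move=> a x y; apply/val_inj; rewrite /= linearP. Qed.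

Definition ker_lift : {linear L -> ker_mod} := lin_of ker_lift_linear.
End Corestriction.
End Kernel.

Section Homological.
Context (A : pzRingType).
Implicit Types K L M N P Q R Y : lmodType A.

Lemma projective_retract P Q (i : {linear Q -> P}) (r : {linear P -> Q}) :
  (forall x, r (i x) = x) -> projective P -> projective Q.
Proof.
move=> ri pP M N g f sg.
have [h hE] := pP M N g (f \o r) sg.
by exists (h \o i) => x; rewrite /= hE /= ri.
Qed.

Lemma projective_prod P Q : projective P -> projective Q ->
  projective (P * Q)%type.
Proof.
move=> pP pQ M N g f sg.
have l1 : linear (fun x : P => f (x, 0)).
  move=> a x y; rewrite -linearP; congr (f _).
  by apply/pair_equal_spec; rewrite /= scaler0 addr0.
have l2 : linear (fun x : Q => f (0, x)).
  move=> a x y; rewrite -linearP; congr (f _).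
  by apply/pair_equal_spec; rewrite /= scaler0 addr0.
have [h1 h1E] := pP M N g (lin_of l1) sg.
have [h2 h2E] := pQ M N g (lin_of l2) sg.
exists ((h1 \o fst) \+ (h2 \o snd)) => -[x y] /=.
rewrite linearD h1E h2E /= -linearD; congr (f _).
by apply/pair_equal_spec; rewrite /= addr0 add0r.
Qed.

Lemma projective_split P M (g : {linear M -> P}) : projective P ->
  surjective_map g -> exists s : {linear P -> M}, forall x, g (s x) = x.
Proof. by move=> pP sg; have [s sE] := pP _ _ g idfun sg; exists s. Qed.

Lemma projective_ker P Q (g : {linear P -> Q}) : projective P ->
  projective Q -> surjective_map g -> projective (ker_mod g).
Proof.
move=> pP pQ sg; have [s sE] := projective_split pQ sg.
have gr x : g ((idfun \- (s \o g)) x) = 0 by rewrite /= linearB sE subrr.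
apply: (@projective_retract P _ (ker_incl g) (ker_lift gr)) => // x.
by apply/val_inj; rewrite /= ker_valE linear0 subr0.
Qed.

Section Combinations.
Context M (n : nat) (b : 'I_n -> M).

Definition comb_fun (x : 'rV[A]_n) : M := \sum_i x 0 i *: b i.

Fact comb_linear : linear comb_fun.
Proof.
move=> a x y; rewrite /comb_fun scaler_sumr -big_split /=.
by apply/eq_bigr => i _; rewrite !mxE scalerDl scalerA.
Qed.

Definition comb : {linear 'rV[A]_n -> M} := lin_of comb_linear.

Lemma combE (c : 'I_n -> A) : comb (\row_i c i) = \sum_i c i *: b i.
Proof. by apply/eq_bigr => i _; rewrite mxE. Qed.
End Combinations.

Lemma linear_comb M N n (b : 'I_n -> M) (f : {linear M -> N}) x :
  f (comb b x) = comb (f \o b) x.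
Proof. by rewrite linear_sum; apply/eq_bigr => i _; rewrite linearZ. Qed.

Lemma comb_delta n (x : 'rV[A]_n) : comb (fun i => delta_mx 0 i) x = x.
Proof. by rewrite [RHS]row_sum_delta. Qed.

Lemma projective_free n : projective 'rV[A]_n.
Proof.
move=> M N g f sg.
have [b bE] := choice (fun i : 'I_n => sg (f (delta_mx 0 i))).
exists (comb b) => x; rewrite linear_comb -[x in RHS]comb_delta linear_comb.
by apply/eq_bigr => i _; rewrite /= bE.
Qed.

Lemma fg_comb M : finitely_generated M ->
  exists n (b : 'I_n -> M), surjective_map (comb b).
Proof.
move=> [n [b bE]]; exists n, b => x.
by have [c ->] := bE x; exists (\row_i c i); rewrite combE.
Qed.

Lemma fg_free n : finitely_generated 'rV[A]_n.
Proof.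
exists n, (fun i => delta_mx 0 i) => x; exists (fun i => x 0 i).
exact: row_sum_delta.
Qed.

Definition short_exact M N P (i : {linear M -> N}) (p : {linear N -> P}) :=
  [/\ injective i, surjective_map p
    & forall x, p x = 0 <-> exists y, i y = x].

Lemma short_exact_ker M N (g : {linear M -> N}) : surjective_map g ->
  short_exact (ker_incl g) g.
Proof.
move=> sg; split=> // [|x]; first exact: val_inj.
by split=> [/in_ker //|[y <-]]; exact: ker_valE.
Qed.

(* The recursive form of pd M <= n, by dimension shifting. *)
Fixpoint pd_le n M : Prop :=
  if n is n'.+1 then
    exists (K P : lmodType A) (i : {linear K -> P}) (p : {linear P -> M}),
      [/\ projective P, short_exact i p & pd_le n' K]
  else projective M.

Lemma pd_le_projdim n M : pd_le n M -> projdim_le M n.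
Proof.
elim: n M => [|n IH] M /=.
  move=> pM; pose P i : lmodType A := if i is 0%N then M else 'rV[A]_0.
  have P0 i (x : P i.+1) : x = 0 by apply/rowP; case.
  exists P, (fun i => \0), idfun; split.
  - by case=> [//|i]; exact: projective_free.
  - by move=> x; exists x.
  - by move=> x; split=> [/= ->|[y <-]//]; exists 0.
  - by move=> i x; split=> [_|//]; exists 0; rewrite [x]P0.
  - by case=> // i _; exact: P0.
move=> [K [P [j [p [pP [injj surp exjp] /IH]]]]].
move=> [R [d [eps [pR surj0 ex0 exd R0]]]].
(* The resolution of the syzygy is shifted by one and spliced to P along j. *)
pose R' i : lmodType A := if i is i'.+1 then R i' else P.
pose d' i : {linear R' i.+1 -> R' i} :=
  match i with 0%N => j \o eps | i'.+1 => d i' end.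
exists R', d', p; split.
- by case.
- exact: surp.
- move=> x; split=> [/exjp[y <-]|[y <-]]; last by apply/exjp; exists (eps y).
  by have [z <-] := surj0 y; exists z.
- case=> [|i] x; last exact: exd.
  rewrite -ex0 /=; split=> [|->]; last exact: linear0.
  by rewrite -[RHS](linear0 j) => /injj.
- by case=> // i; exact: R0.
Qed.

Lemma projdim_pd_le n M : projdim_le M n -> pd_le n M.
Proof.
elim: n M => [|n IH] M [R [d [eps [pR surj0 ex0 exd R0]]]] /=.
  have injeps x : eps x = 0 -> x = 0.
    by move=> /ex0[y <-]; rewrite (R0 1%N isT y) linear0.
  have [s sE] := choice surj0.
  have ls : linear s.
    move=> a x y; apply/eqP; rewrite -subr_eq0; apply/eqP/injeps.
    by rewrite linearB linearP !sE subrr.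
  apply: (@projective_retract (R 0%N) _ (lin_of ls) eps) => //.
exists (ker_mod eps), (R 0%N), (ker_incl eps), eps; split => //.
  exact: short_exact_ker.
have e0 x : eps (d 0%N x) = 0 by apply/ex0; exists x.
apply: IH; exists (fun i => R i.+1), (fun i => d i.+1), (ker_lift e0).
split=> // [||i i_gt]; last exact: R0.
- by move=> z; have /ex0[y dy] := ker_valE z; exists y; apply/val_inj.
- move=> x; rewrite -exd; split=> [/(congr1 val)//|dx].
  by apply/val_inj.
Qed.

(* Schanuel's lemma. With b : P' -> P over M, an element y of P' lies in K'   *)
(* iff b y lies in K. Hence, if 0 -> L -> R -> K is the start of a resolution *)
(* of K, the projective module {(r, y) | r + b y = 0} maps onto K' with       *)
(* kernel L.                                                                  *)
Lemma schanuel n M K P (K' P' : lmodType A)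
    (i : {linear K -> P}) (p : {linear P -> M})
    (i' : {linear K' -> P'}) (p' : {linear P' -> M}) :
  projective P -> projective P' -> short_exact i p -> short_exact i' p' ->
  pd_le n K -> pd_le n K'.
Proof.
move=> pP pP' [inji surjp ex] [inji' surjp' ex'].
have [a aE] := pP _ _ p' p surjp'.
have [b bE] := pP' _ _ p p' surjp.
(* The map w sends (x, y) to y - a (i x + b y), which p' kills, so it factors through K' as k'. *)
pose w : {linear (K * P')%type -> P'} :=
  snd \- (a \o ((i \o fst) \+ (b \o snd))).
have [k' k'E] : exists k' : {linear (K * P')%type -> K'},
    forall x, i' (k' x) = w x.
  have h (x : K * P') : exists y, i' y = w x.
    apply/ex'; rewrite linearB /= aE linearD bE.
    by have /ex-> : exists y, i y = i x.1; [exists x.1 | rewrite add0r subrr].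
  have [r rE] := choice h.
  have lr : linear r by move=> c x y; apply: inji'; rewrite linearP !rE linearP.
  by exists (lin_of lr).
have [k kE] : exists k : {linear K' -> K}, forall y, i (k y) = b (i' y).
  have h (y : K') : exists x, i x = b (i' y).
    by apply/ex; rewrite bE; apply/ex'; exists y.
  have [r rE] := choice h.
  have lr : linear r by move=> c x y; apply: inji; rewrite linearP !rE !linearP.
  by exists (lin_of lr).
case: n => [|n] /=.
  (* For K projective, K' is a retract of K * P': since i (k y) = b (i' y), the argument of a in w
     vanishes at (- k y, i' y), and k' returns y. *)
  move=> pK; have lj : linear (fun y : K' => (- k y, i' y)).
    move=> c x y; apply/pair_equal_spec.
    by rewrite !linearP.
  apply: (@projective_retract (K * P')%type _ (lin_of lj) k').
    move=> y; apply: inji'; rewrite k'E /= linearN kE addNr linear0.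
    by rewrite subr0.
  exact: projective_prod.
move=> [L [R [j [q [pR [injj surjq exq] pL]]]]].
pose t : {linear (R * P')%type -> P} := (i \o q \o fst) \+ (b \o snd).
have surjt : surjective_map t.
  move=> x; have [y yE] : exists y, i y = x - b (a x).
    by apply/ex; rewrite linearB bE aE subrr.
  have [z zE] := surjq y.
  by exists (z, a x); rewrite /t /= zE yE subrK.
have tr (x : ker_mod t) : p' (val x).2 = 0.
  rewrite -bE; have /eqP := ker_valE x.
  rewrite /t /= addrC addr_eq0 => /eqP ->; rewrite linearN.
  by apply/oppr_inj; rewrite opprK oppr0; apply/ex; eexists.
have [u uE] : exists u : {linear ker_mod t -> K'},
    forall x, i' (u x) = (val x).2.
  have h (x : ker_mod t) : exists y, i' y = (val x).2 by apply/ex'; exact: tr.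
  have [r rE] := choice h.
  have lr : linear r by move=> c x y; apply: inji'; rewrite linearP !rE.
  by exists (lin_of lr).
have jt x : t ((fun x => (j x, 0)) x) = 0.
  rewrite /t /= linear0 addr0; suff -> : q (j x) = 0 by rewrite linear0.
  by apply/exq; exists x.
have lj : linear (fun x : L => (j x, 0 : P')).
  by move=> c x y; apply/pair_equal_spec; rewrite /= linearP scaler0 addr0.
have jt' x : t (lin_of lj x) = 0 by exact: jt.
exists L, (ker_mod t), (ker_lift jt'), u; split=> //.
  by apply: projective_ker => //; exact: projective_prod.
split.
- by move=> x y /(congr1 (fst \o val)) /= /injj.
- move=> y; have [z zE] := surjq (- k y).
  have /in_ker[x xE] : t (z, i' y) = 0.
    by rewrite /t /= zE linearN kE addNr.
  exists x; apply: inji'; rewrite uE.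
  by rewrite -[val x]/(ker_incl t x) xE.
move=> x; split=> [ux|[y <-]]; last first.
  by apply: inji'; rewrite uE linear0.
have x2 : (val x).2 = 0 by rewrite -uE ux linear0.
have /exq[y yE] : q (val x).1 = 0.
  have := ker_valE x; rewrite /t /= x2 linear0 addr0 -(linear0 i).
  exact: inji.
exists y; apply/val_inj => /=; rewrite yE -x2.
by rewrite -surjective_pairing.
Qed.

Lemma pd_le_iso n M N (f : {linear M -> N}) :
  bijective f -> pd_le n M -> pd_le n N.
Proof.
move=> [g fK gK].
have lg : linear g.
  by move=> a x y; apply: (can_inj fK); rewrite linearP !gK.
case: n => [|n] /=; first exact: (@projective_retract M N (lin_of lg) f gK).
move=> [K [P [i [p [pP [inji surjp ex] pK]]]]].
exists K, P, i, (f \o p); split=> //; split=> //.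
  by move=> y; have [x xE] := surjp (g y); exists x; rewrite /= xE gK.
move=> x; rewrite -ex /=; split=> [|->]; last by rewrite linear0.
by move=> fx; rewrite -[p x]fK fx; exact: (linear0 (lin_of lg)).
Qed.

Lemma fin_projdimP M :
  fin_projdim A M <-> finitely_generated M /\ exists n, pd_le n M.
Proof.
by split=> -[fM [n h]]; split=> //; exists n;
  [exact: projdim_pd_le | exact: pd_le_projdim].
Qed.

(** Every object of the subcategory is then projective, so any free module mapping onto M is an
    approximation. *)
Lemma lfindim0_contravariantly_finite :
  is_lfindim A 0 -> contravariantly_finite (fin_projdim A).
Proof.
move=> [fd0 _] M /fg_comb[n [b sb]].
exists 'rV[A]_n, (comb b); split.
  apply/fin_projdimP; split; first exact: fg_free.
  by exists 0%N; exact: projective_free.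
move=> Y f /fd0 /projdim_pd_le /(_ _ _ (comb b) f sb)[h hE].
by exists h => y; rewrite hE.
Qed.

End Homological.

(** * Corners and inflation *)

Section Cut.
Context (A : pzRingType) (e : A) (he : e * e = e).

(** * The corner eM as a module over eAe *)

Section CutModule.
Context (M : lmodType A).

Definition cut_pred : {pred M} := fun x => e *: x == x.

Lemma cut_pred_zmod_closed : zmod_closed cut_pred.
Proof.
split; first by rewrite /in_mem /= /cut_pred scaler0.
move=> x y; rewrite /in_mem /= /cut_pred => /eqP ex /eqP ey.
by rewrite scalerBr ex ey.
Qed.

HB.instance Definition _ :=
  GRing.isZmodClosed.Build M cut_pred cut_pred_zmod_closed.

(** The proof h is part of the type because the ring acting on it, [corner he], depends on that
    proof. *)
Record cut_mod_of (h : e * e = e) :=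
  CutMod { cut_val : M; cut_valP : cut_val \in cut_pred }.
Local Notation cut_mod := (cut_mod_of he).

HB.instance Definition _ := [isSub for @cut_val he].
HB.instance Definition _ := [Choice of cut_mod by <:].
HB.instance Definition _ := [SubChoice_isSubZmodule of cut_mod by <:].

Lemma cut_valE (x : cut_mod) : e *: val x = val x.
Proof. exact/eqP/cut_valP. Qed.

Fact cut_scale_subproof (b : corner he) (x : cut_mod) :
  val b *: val x \in cut_pred.
Proof. by apply/eqP; rewrite scalerA corner_mull. Qed.

Definition cut_scale (b : corner he) (x : cut_mod) : cut_mod :=
  CutMod he (cut_scale_subproof b x).

Fact cut_scaleA a b x : cut_scale a (cut_scale b x) = cut_scale (a * b) x.
Proof. by apply/val_inj; rewrite /= scalerA. Qed.

Fact cut_scale1 : left_id 1 cut_scale.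
Proof. by move=> x; apply/val_inj; rewrite /= cut_valE. Qed.

Fact cut_scaleDr : right_distributive cut_scale +%R.
Proof. by move=> a x y; apply/val_inj; rewrite /= scalerDr. Qed.

Fact cut_scaleDl x : {morph cut_scale^~ x : a b / a + b}.
Proof. by move=> a b; apply/val_inj; rewrite /= scalerDl. Qed.

HB.instance Definition _ := GRing.Zmodule_isLmodule.Build (corner he) cut_mod
  cut_scaleA cut_scale1 cut_scaleDr cut_scaleDl.

Lemma cut_val_linear (b : corner he) (x y : cut_mod) :
  val (b *: x + y) = val b *: val x + val y.
Proof. by []. Qed.

Fact cut_proj_subproof (x : M) : e *: x \in cut_pred.
Proof. by apply/eqP; rewrite scalerA he. Qed.

Definition cut_proj (x : M) : cut_mod := CutMod he (cut_proj_subproof x).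

Lemma cut_projK (x : cut_mod) : cut_proj (val x) = x.
Proof. by apply/val_inj; rewrite /= cut_valE. Qed.
End CutModule.

Local Notation cut_mod M := (cut_mod_of M he).

Section CutMap.
Context (M N : lmodType A) (f : {linear M -> N}).

Fact cut_map_subproof (x : cut_mod M) : f (val x) \in @cut_pred N.
Proof. by apply/eqP; rewrite -linearZ cut_valE. Qed.

Definition cut_map_fun (x : cut_mod M) : cut_mod N :=
  CutMod he (cut_map_subproof x).

Fact cut_map_linear : linear cut_map_fun.
Proof. by move=> a x y; apply/val_inj; rewrite /= linearD linearZ. Qed.

Definition cut_map : {linear cut_mod M -> cut_mod N} := lin_of cut_map_linear.
End CutMap.

Lemma cut_short_exact (M N P : lmodType A) (i : {linear M -> N})
    (p : {linear N -> P}) :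
  short_exact i p -> short_exact (cut_map i) (cut_map p).
Proof.
move=> [inji surjp ex]; split.
- by move=> x y /(congr1 val) /= /inji /val_inj.
- move=> y; have [x xE] := surjp (val y); exists (cut_proj x).
  by apply/val_inj; rewrite /= linearZ /= xE cut_valE.
move=> x; split=> [/(congr1 val) /= /ex[y yE]|[y <-]]; last first.
  by apply/val_inj; rewrite /=; apply/ex; exists (val y).
exists (cut_proj y); apply/val_inj.
by rewrite /= linearZ /= yE; exact: cut_valE.
Qed.

(** Equivalently eA(1 - e) = 0, which makes a |-> ea multiplicative and eA = eAe. *)
Hypothesis tri : forall a : A, e * a * e = e * a.

Fact corner_proj_subproof (a : A) : e * a \in corner_pred e.
Proof. by apply/eqP; rewrite !mulrA he tri. Qed.

Definition corner_proj (a : A) : corner he :=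
  Corner he (corner_proj_subproof a).

Lemma corner_projK (b : corner he) : corner_proj (val b) = b.
Proof. by apply/val_inj; rewrite /= corner_mull. Qed.

Lemma cut_fg (M : lmodType A) : finitely_generated M ->
  finitely_generated (cut_mod M).
Proof.
move=> [n [b bE]]; exists n, (fun i => cut_proj (b i)) => x.
have [c cE] := bE (val x); exists (fun i => corner_proj (c i)); apply/val_inj.
rewrite -cut_valE cE scaler_sumr raddf_sum; apply/eq_bigr => i _.
by rewrite /= !scalerA !tri.
Qed.

(* An eAe-module, seen as an A-module through the ring morphism a |-> ea.     *)
Definition inflate (t : forall a : A, e * a * e = e * a)
  (X : lmodType (corner he)) : Type := X.

Section Inflation.
Context (X : lmodType (corner he)).
HB.instance Definition _ := GRing.Zmodule.on (inflate tri X).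

Definition inflate_scale (a : A) (x : inflate tri X) : inflate tri X :=
  corner_proj a *: (x : X).

Fact inflate_scaleA a b x :
  inflate_scale a (inflate_scale b x) = inflate_scale (a * b) x.
Proof.
rewrite /inflate_scale scalerA; congr (_ *: _).
by apply/val_inj; rewrite /= !mulrA tri.
Qed.

Fact inflate_scale1 : left_id 1 inflate_scale.
Proof.
move=> x; rewrite /inflate_scale -[RHS](@scale1r _ X); congr (_ *: _).
by apply/val_inj; rewrite /= mulr1.
Qed.

Fact inflate_scaleDr : right_distributive inflate_scale +%R.
Proof. by move=> a x y; exact: (@scalerDr _ X). Qed.

Fact inflate_scaleDl x : {morph inflate_scale^~ x : a b / a + b}.
Proof.
move=> a b; rewrite /inflate_scale -scalerDl; congr (_ *: _).
by apply/val_inj; rewrite /= mulrDr.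
Qed.

HB.instance Definition _ := GRing.Zmodule_isLmodule.Build A (inflate tri X)
  inflate_scaleA inflate_scale1 inflate_scaleDr inflate_scaleDl.

Definition of_inflate (x : inflate tri X) : X := x.

Lemma of_inflateD x y : of_inflate (x + y) = of_inflate x + of_inflate y.
Proof. by []. Qed.

Lemma inflateZ a (x : inflate tri X) :
  of_inflate (a *: x) = corner_proj a *: of_inflate x.
Proof. by []. Qed.

Lemma inflate_fg : finitely_generated X -> finitely_generated (inflate tri X).
Proof.
move=> [n [b bE]]; exists n, b => x; have [c cE] := bE x.
exists (val \o c); rewrite [LHS]cE; apply/eq_bigr => i _.
by rewrite -[RHS]/(of_inflate _) inflateZ corner_projK.
Qed.
End Inflation.

Definition inflate_map (X Y : lmodType (corner he)) (f : {linear X -> Y}) :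
    {linear inflate tri X -> inflate tri Y} :=
  @lin_of A (inflate tri X) (inflate tri Y) f
    (fun a x y => linearP f (corner_proj a) x y).

(* The unit M -> eM of the adjunction between cutting and inflation. As       *)
(* inflation preserves surjections, cutting preserves projectives.            *)
Fact cut_unit_linear (M : lmodType A) :
  linear (@cut_proj M : M -> inflate tri (cut_mod M)).
Proof.
move=> a x y; apply/val_inj => /=; rewrite scalerDr !scalerA.
by congr (_ + _); rewrite tri.
Qed.

Definition cut_unit (M : lmodType A) :
    {linear M -> inflate tri (cut_mod M)} :=
  lin_of (@cut_unit_linear M).

Lemma cut_projective (P : lmodType A) : projective P -> projective (cut_mod P).
Proof.
move=> pP M N g f sg.
(* The lifting problem is inflated to A and precomposed with the unit, solved on P, and its solution
   restricted to eP. *)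
have [h hE] := pP _ _ (inflate_map g) (inflate_map f \o cut_unit P) sg.
have lh : linear ((fun x : cut_mod P => h (val x)) : _ -> M).
  move=> a x y; rewrite linearD /= linearZ /=.
  by rewrite -[val a *: _]/(of_inflate _) inflateZ corner_projK.
exists (lin_of lh) => x; have /= -> := hE (val x).
by rewrite cut_projK.
Qed.

Lemma cut_pd_le n (M : lmodType A) : pd_le n M -> pd_le n (cut_mod M).
Proof.
elim: n M => [|n IH] M /=; first exact: cut_projective.
move=> [K [P [i [p [pP ex /IH pK]]]]].
exists (cut_mod K), (cut_mod P), (cut_map i), (cut_map p).
by split=> //; [exact: cut_projective | exact: cut_short_exact].
Qed.
End Cut.

(** * Modules over a finite dimensional algebra *)

Section Spans.
Context (K : fieldType) (A : pzRingType) (iota : {rmorphism K -> A}).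

(** * Linear algebra over K inside A-modules, through [iota] *)

Section Span.
Context (M : lmodType A).
Implicit Types (x y : M) (U : M -> Prop).

Definition subspace U : Prop :=
  U 0 /\ forall c x y, U x -> U y -> U (iota c *: x + y).

Definition kspan (I : finType) (b : I -> M) x : Prop :=
  exists c : I -> K, x = \sum_i iota (c i) *: b i.

Lemma subspace_sum U (I : finType) (c : I -> K) (b : I -> M) :
  subspace U -> (forall i, U (b i)) -> U (\sum_i iota (c i) *: b i).
Proof.
move=> [U0 UP] Ub; elim/big_ind: _ => // [x y Ux Uy|i _].
  by rewrite -[x]scale1r -(rmorph1 iota); exact: UP.
by rewrite -[_ *: _]addr0; exact: UP.
Qed.

Lemma subspace_kspan (I : finType) (b : I -> M) : subspace (kspan b).
Proof.
split.
  by exists (fun=> 0); rewrite big1 // => i _; rewrite rmorph0 scale0r.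
move=> d x y [a ->] [c ->]; exists (fun i => d * a i + c i).
rewrite scaler_sumr -big_split; apply/eq_bigr => i _ /=.
by rewrite rmorphD rmorphM scalerDl scalerA.
Qed.

Lemma kspan_ord (I : finType) (b : I -> M) x :
  kspan b x -> kspan (fun j : 'I_#|I| => b (enum_val j)) x.
Proof.
move=> [c ->]; exists (fun j => c (enum_val j)).
by rewrite (reindex _ (onW_bij _ (@enum_val_bij I))).
Qed.

(** Induction on n: the part of U in the span of all b but the first has a basis, and U exceeds it
    by at most one dimension, filled by any x0 of U outside that span. *)
Lemma subspace_basis n (b : 'I_n -> M) U : subspace U ->
  (forall x, U x -> kspan b x) ->
  exists k (u : 'I_k -> M),
    [/\ forall i, U (u i), forall x, U x -> kspan u x
      & forall c : 'I_k -> K,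
          \sum_i iota (c i) *: u i = 0 -> forall i, c i = 0].
Proof.
elim: n b U => [|n IH] b U [U0 UP] Ub.
  exists 0%N, b; split=> // [|? _]; by case.
pose b' i := b (lift ord0 i).
have [S0 SP] := subspace_kspan b'.
have [|//|k [u [Uu uU u_free]]] := IH b' (fun x => U x /\ kspan b' x).
- by split=> // c x y [Ux bx] [Uy By]; split; [exact: UP | exact: SP].
- by move=> x [].
case: (pselect (forall x, U x -> kspan b' x)) => [Ub'|].
  exists k, u; split=> // [i|x Ux]; first by have [] := Uu i.
  by apply: uU; split=> //; exact: Ub'.
move=> /existsNP[x0 /not_implyP[Ux0 nbx0]].
have split_b x : U x -> exists c, kspan b' (x - iota c *: b ord0).
  move=> /Ub[c ->]; exists (c ord0), (fun i => c (lift ord0 i)).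
  by rewrite big_ord_recl addrC addKr.
have [c0 bc0] := split_b _ Ux0.
have c0N0 : c0 != 0.
  apply: contra_notN nbx0 => /eqP c00; move: bc0.
  by rewrite c00 rmorph0 scale0r subr0.
pose u' i := oapp u x0 (unlift ord0 i).
have u'0 : u' ord0 = x0 by rewrite /u' unlift_none.
have u'l i : u' (lift ord0 i) = u i by rewrite /u' liftK.
exists k.+1, u'; split.
- by move=> i; rewrite /u'; case: unlift => //= j; have [] := Uu j.
- move=> x Ux; have [d bd] := split_b _ Ux.
  (* Subtracting d / c0 times x0 cancels the coefficient d of x at [b ord0]. *)
  have /uU[c cE] : U (iota (- (d / c0)) *: x0 + x) /\
                   kspan b' (iota (- (d / c0)) *: x0 + x).
    split; first exact: UP.
    have -> : iota (- (d / c0)) *: x0 + x =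
        iota (- (d / c0)) *: (x0 - iota c0 *: b ord0) + (x - iota d *: b ord0).
      rewrite scalerBr [iota _ *: (_ *: _)]scalerA -[_ * iota c0]rmorphM.
      rewrite mulNr divfK // [iota (- d)]rmorphN [- iota d *: _]scaleNr opprK.
      by rewrite -addrA [iota d *: _ + _]addrC subrK.
    exact: SP.
  exists (fun i => oapp c (d / c0) (unlift ord0 i)).
  rewrite big_ord_recl unlift_none u'0 /=.
  under eq_bigr => i _ do rewrite liftK u'l /=.
  by rewrite -cE rmorphN scaleNr addNKr.
move=> c; rewrite big_ord_recl u'0.
under eq_bigr => i _ do rewrite u'l.
have [c00|c'N0] := eqVneq (c ord0) 0.
  rewrite c00 rmorph0 scale0r add0r => /u_free c'0 i.
  by case: (unliftP ord0 i) => [j ->|->] //; exact: c'0.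
(* Dividing the relation by the nonzero coefficient of x0 would put x0 in the smaller span. *)
move=> /eqP; rewrite addr_eq0 => /eqP cx0; case: nbx0.
rewrite -[x0]scale1r -(rmorph1 iota) -(mulVf c'N0) rmorphM -scalerA cx0.
rewrite -[_ *: _]addr0 scalerN -scaleNr -rmorphN.
apply: SP => //; apply: subspace_sum; first exact: subspace_kspan.
by move=> i; have [] := Uu i.
Qed.
End Span.

Hypothesis fdA : exists n (g : 'I_n -> A),
  forall a, exists c : 'I_n -> K, a = \sum_i iota (c i) * g i.

Lemma fg_kspan (M : lmodType A) : finitely_generated M ->
  exists n (b : 'I_n -> M), forall x, kspan b x.
Proof.
have [n [g gE]] := fdA; move=> [m [b bE]].
pose h (ij : 'I_m * 'I_n) := g ij.2 *: b ij.1.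
exists #|{: 'I_m * 'I_n}|, (fun j => h (enum_val j)) => x; apply: kspan_ord.
have [a ->] := bE x; have [c cE] := choice (fun i => gE (a i)).
exists (fun ij => c ij.1 ij.2).
rewrite -(pair_bigA _ (fun i j => iota (c i j) *: h (i, j))) /=.
apply/eq_bigr => i _; rewrite {1}cE scaler_suml; apply/eq_bigr => j _.
by rewrite scalerA.
Qed.

Lemma kspan_fg (M : lmodType A) n (b : 'I_n -> M) :
  (forall x, kspan b x) -> finitely_generated M.
Proof.
by move=> bE; exists n, b => x; have [c ->] := bE x; exists (iota \o c).
Qed.

(** Over a finite dimensional algebra, finitely generated means finite dimensional over K, a
    property inherited by subspaces. *)
Lemma fg_submodule (N M : lmodType A) (i : {linear N -> M}) : injective i ->
  finitely_generated M -> finitely_generated N.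
Proof.
move=> inji /fg_kspan[n [b bE]].
have sU : subspace (fun x => exists y, i y = x).
  split; first by exists 0; rewrite linear0.
  by move=> c _ _ [x <-] [y <-]; exists (iota c *: x + y); rewrite linearP.
have [k [u [Uu uU _]]] := subspace_basis sU (fun x _ => bE x).
have [v vE] := choice Uu.
apply: (@kspan_fg _ k v) => x.
have [c cE] := uU (i x) (ex_intro _ x erefl); exists c.
apply: inji; rewrite cE linear_sum; apply/eq_bigr => j _.
by rewrite linearZ /= vE.
Qed.

Lemma fg_prod (M N : lmodType A) : finitely_generated M ->
  finitely_generated N -> finitely_generated (M * N)%type.
Proof.
move=> /fg_comb[m [b bE]] /fg_comb[n [c cE]].
exists (m + n)%N, (fun i => match split i with
  inl j => (b j, 0) | inr j => (0, c j) end) => -[x y].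
have [u <-] := bE x; have [v <-] := cE y.
exists (row_mx u v 0); rewrite big_split_ord /=; apply/pair_equal_spec.
have fstS l (r : 'I_l -> (M * N)%type) : (\sum_i r i).1 = \sum_i (r i).1.
  exact: (linear_sum (fst : {linear (M * N)%type -> M})).
have sndS l (r : 'I_l -> (M * N)%type) : (\sum_i r i).2 = \sum_i (r i).2.
  exact: (linear_sum (snd : {linear (M * N)%type -> N})).
rewrite /= !fstS !sndS.
split.
  rewrite [X in _ = _ + X]big1 ?addr0 => [|i _]; last first.
    by rewrite (unsplitK (inr i)) /= scaler0.
  by apply/eq_bigr => i _; rewrite (unsplitK (inl i)) row_mxEl.
rewrite [X in _ = X + _]big1 ?add0r => [|i _]; last first.
  by rewrite (unsplitK (inl i)) /= scaler0.
by apply/eq_bigr => i _; rewrite (unsplitK (inr i)) row_mxEr.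
Qed.

(** The kernel of E - 1 is the image of the idempotent E, a retract of the free module. *)
Lemma projective_idem k (E : 'M[A]_k) : E *m E = E ->
  projective (ker_mod (mulmxr E \- idfun : {linear 'rV[A]_k -> 'rV[A]_k})).
Proof.
move=> EE; have Er x :
    (mulmxr E \- idfun : {linear 'rV[A]_k -> 'rV[A]_k}) (mulmxr E x) = 0.
  by rewrite /= -mulmxA EE subrr.
apply: (projective_retract (i := ker_incl _) (r := ker_lift Er)).
  by move=> x; apply/val_inj/subr0_eq; exact: ker_valE x.
exact: projective_free.
Qed.

Section Cover.
Hypothesis iotaC : forall c a, iota c * a = a * iota c.
Context (f g : A).
Hypotheses (ff : f * f = f) (gf1 : g + f = 1) (gAf : forall a, g * a * f = 0).
Hypothesis fpd0 : forall Z : lmodType A, finitely_generated Z ->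
  (forall x : Z, g *: x = 0) -> exists n, pd_le n Z.

(* {x | x E = x} (+) (Af)^n is projective and maps onto M. As g kills Af, and *)
(* as {x | x E = x} -> M becomes injective after multiplication by g, the     *)
(* kernel is annihilated by g.                                                *)
Lemma fpd_of_cover (M : lmodType A) k (m : 'I_k -> M) (E : 'M[A]_k) :
  finitely_generated M -> E *m E = E ->
  (forall j, \sum_i E j i *: m i = m j) ->
  (forall x, exists c : 'I_k -> A, g *: x = \sum_i c i *: m i) ->
  (forall x : 'rV[A]_k, x *m E = x -> comb m x = 0 -> g *: x = x -> x = 0) ->
  exists n, pd_le n M.
Proof.
move=> fgM EE Em mgen minj; have [n [b bE]] := fg_kspan fgM.
have gf0 : g * f = 0 by rewrite -[g]mulr1 gAf.
have gg : g * g = g by rewrite -[RHS]mulr1 -gf1 mulrDr gf0 addr0.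
have mulf (x : 'rV[A]_n) i : (x *m f%:M) 0 i = x 0 i * f.
  rewrite mxE (bigD1 i) //= mxE eqxx mulr1n big1 ?addr0 // => j /negPf ij.
  by rewrite mxE ij mulr0n mulr0.
have FF : (f%:M : 'M[A]_n) *m f%:M = f%:M by rewrite -scalar_mxM ff.
have combEm x : comb m (x *m E) = comb m x.
  rewrite [LHS]/= /comb_fun; under eq_bigr => i _ do rewrite mxE scaler_suml.
  rewrite exchange_big; apply/eq_bigr => j _ /=.
  rewrite -[in RHS]Em scaler_sumr.
  by apply/eq_bigr => i _; rewrite scalerA.
have := projective_idem EE; have := projective_idem FF.
set F := (X in projective (ker_mod X)) => pF.
set G := (X in projective (ker_mod X)) => pG.
pose p : {linear (ker_mod G * ker_mod F)%type -> M} :=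
  (comb m \o ker_incl G \o fst) \+ (comb b \o ker_incl F \o snd).
have surjp : surjective_map p.
  move=> z; have [c cE] := mgen z; have [d dE] := bE z.
  have /in_ker[x xE] : G ((\row_i c i) *m E) = 0.
    by rewrite /G /= -mulmxA EE subrr.
  have /in_ker[y yE] : F ((\row_i iota (d i)) *m f%:M) = 0.
    by rewrite /F /= -mulmxA FF subrr.
  (* Split z = gz + fz: the first summand covers gz, and the second covers fz because f commutes
     with the scalars of K. *)
  exists (x, y); rewrite -[p _]/(comb m (ker_incl G x) + comb b (ker_incl F y)).
  rewrite xE yE combEm combE -cE -[RHS]scale1r -gf1 scalerDl; congr (_ + _).
  rewrite {1}dE scaler_sumr; apply/eq_bigr => i _.
  by rewrite mulf mxE scalerA iotaC.
have fgP : finitely_generated (ker_mod G * ker_mod F)%type.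
  apply: fg_prod.
    by apply: (@fg_submodule _ _ (ker_incl G)); [exact: val_inj|exact: fg_free].
  by apply: (@fg_submodule _ _ (ker_incl F)); [exact: val_inj|exact: fg_free].
have [||l pd] := fpd0 (Z := ker_mod p).
- by apply: (@fg_submodule _ _ (ker_incl p)) => //; exact: val_inj.
- move=> z; have zE := ker_valE z.
  set x := val (val z).1; set y := val (val z).2.
  have xE : x *m E = x by apply/subr0_eq; exact: ker_valE (val z).1.
  have yE : y *m f%:M = y by apply/subr0_eq; exact: ker_valE (val z).2.
  have gy : g *: y = 0 by apply/rowP => i; rewrite mxE -yE mulf mulrA gAf mxE.
  (* As gy = 0, multiplying the kernel relation by g shows that gx maps to 0, and [minj] applies to
     gx. *)
  have gx : g *: x = 0.
    apply: minj; first by rewrite -scalemxAl xE.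
      have cgy : g *: comb b y = 0 by rewrite -linearZ gy linear0.
      rewrite linearZ; have := congr1 (fun t => g *: t) zE.
      by rewrite -[p _]/(comb m x + comb b y) /= scalerDr cgy addr0 scaler0.
    by rewrite scalerA gg.
  by apply/val_inj/pair_equal_spec; split; apply/val_inj.
exists l.+1, (ker_mod p), (ker_mod G * ker_mod F)%type, (ker_incl p), p.
by split=> //; [exact: projective_prod | exact: short_exact_ker].
Qed.
End Cover.
End Spans.

(** * Approximations over A and over eAe *)

Section CornerApproximation.
Context (K : fieldType) (A : pzRingType) (iota : {rmorphism K -> A}).
Hypothesis fdA : exists n (g : 'I_n -> A),
  forall a, exists c : 'I_n -> K, a = \sum_i iota (c i) * g i.
Hypothesis iotaC : forall c a, iota c * a = a * iota c.
Context (e : A) (he : e * e = e).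
Hypothesis tri : forall a : A, e * a * e = e * a.
Hypothesis fpd0 : forall Z : lmodType A, finitely_generated Z ->
  (forall x : Z, e *: x = 0) -> exists n, pd_le n Z.

Local Notation B := (corner he).
Local Notation cut_mod M := (cut_mod_of M he).

(* A splitting of B^k -> eM is an idempotent matrix over eAe; its image on    *)
(* A^k is a projective A-module whose corner is eM.                           *)
Lemma fpd_of_cut_projective (M : lmodType A) : finitely_generated M ->
  projective (cut_mod M) -> exists n, pd_le n M.
Proof.
move=> fgM pV; have [k [b bE]] := fg_comb (cut_fg he tri fgM).
have [s sE] := projective_split pV bE.
pose E : 'M[A]_k := \matrix_(i, j) val (s (b i) 0 j).
have val_comb (y : 'rV[B]_k) : val (comb b y) = \sum_i val (y 0 i) *: val (b i).
  by rewrite [LHS]raddf_sum.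
have val_s (y : 'rV[B]_k) j :
    val (s (comb b y) 0 j) = \sum_i val (y 0 i) * E i j.
  rewrite linear_comb summxE raddf_sum; apply/eq_bigr => i _.
  by rewrite !mxE.
apply: (@fpd_of_cover _ _ iota fdA iotaC (1 - e) e _ _ _ fpd0 M k
  (fun i => val (b i)) E) => //.
- by rewrite mulrBr mulr1 mulrBl mul1r he subrr subr0.
- by rewrite addrC subrK.
- by move=> a; rewrite mulrBr mulr1 tri subrr.
- apply/matrixP => i j; rewrite !mxE -[in RHS](sE (b i)) val_s.
  by apply/eq_bigr => l _; rewrite !mxE.
- move=> j; rewrite -[in RHS](sE (b j)) val_comb.
  by apply/eq_bigr => i _; rewrite mxE.
- move=> x; have [y yE] := bE (cut_proj he x).
  exists (fun i => val (y 0 i)); rewrite -val_comb yE.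
  by [].
(* The entries of x = ex lie in eA = eAe, so x comes from a row y over B with b(y) = 0; then x = xE
   is s(b(y)) = 0. *)
move=> x xE bx ex; pose y : 'rV[B]_k := \row_i corner_proj he tri (x 0 i).
have yx i : val (y 0 i) = x 0 i by rewrite mxE /= -[in RHS]ex mxE.
have by0 : comb b y = 0.
  by apply/val_inj; rewrite val_comb -[RHS]bx; apply/eq_bigr => i _; rewrite yx.
apply/rowP => j; rewrite -xE !mxE.
under eq_bigr => i _ do rewrite -yx.
by rewrite -val_s by0 linear0 mxE.
Qed.

(** Cutting a free presentation of M gives a projective presentation of eM, so by Schanuel's lemma
    the corner of the kernel has dimension at most n and the induction hypothesis applies to the
    kernel. *)
Lemma fpd_of_cut n (M : lmodType A) : finitely_generated M ->
  pd_le n (cut_mod M) -> exists m, pd_le m M.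
Proof.
elim: n M => [|n IH] M fgM; first exact: fpd_of_cut_projective.
move=> [K0 [P [i [p [pP ex pK]]]]].
have [k [b bE]] := fg_comb fgM.
have exb := short_exact_ker bE.
have [||m pm] := IH (ker_mod (comb b)).
- apply: (fg_submodule fdA (i := ker_incl _)); first exact: val_inj.
  exact: fg_free.
- apply: (schanuel pP _ ex (cut_short_exact he exb)) pK.
  exact/cut_projective/projective_free.
exists m.+1, (ker_mod (comb b)), 'rV[A]_k, (ker_incl (comb b)), (comb b).
by split=> //; exact: projective_free.
Qed.

Lemma fin_projdim_cut (M : lmodType A) : finitely_generated M ->
  fin_projdim A M <-> fin_projdim B (cut_mod M).
Proof.
move=> fgM; split=> /fin_projdimP[_ [n pn]]; apply/fin_projdimP.
  by split; [exact: cut_fg | exists n; exact: cut_pd_le].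
by split=> //; exact: fpd_of_cut pn.
Qed.

(** * The pullback of X -> eM <- M over A *)

Section Pullback.
Context (M : lmodType A) (X : lmodType B) (phi : {linear X -> cut_mod M}).

Definition pullback_map :
    {linear (inflate tri X * M)%type -> inflate tri (cut_mod M)} :=
  (inflate_map tri phi \o fst) \- (cut_unit he tri M \o snd).

Definition pullback := ker_mod pullback_map.

Lemma pullbackE (z : pullback) : phi (val z).1 = cut_proj he (val z).2.
Proof. by apply/subr0_eq; exact: ker_valE z. Qed.

Definition pullback_fst (z : cut_mod pullback) : X :=
  of_inflate (ker_incl pullback_map (val z)).1.

Fact pullback_fst_linear : linear pullback_fst.
Proof.
move=> a x y; rewrite /pullback_fst cut_val_linear linearP.
by rewrite of_inflateD inflateZ corner_projK.
Qed.

(** The inverse is x |-> (x, phi x): if (x, y) is fixed by e, then y = ey, and ey = phi x by the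
    pullback condition. *)
Lemma pullback_fst_bij : bijective pullback_fst.
Proof.
have h (x : X) : pullback_map (x, val (phi x)) = 0.
  by rewrite /= cut_projK subrr.
have h' (x : X) : KerMod (introT eqP (h x)) \in @cut_pred _ e (pullback).
  apply/eqP/val_inj/pair_equal_spec; rewrite /=; split; last exact: cut_valE.
  rewrite -[LHS]/(of_inflate (e *: (x : inflate tri X))) inflateZ.
  have -> : corner_proj he tri e = 1 by apply/val_inj.
  exact: (scale1r (of_inflate x)).
exists (fun x => CutMod he (h' x)) => [z|//].
apply/val_inj/val_inj; rewrite [RHS]surjective_pairing.
apply/pair_equal_spec; split; first by [].
by rewrite /= /pullback_fst pullbackE /= -[in RHS]cut_valE.
Qed.
End Pullback.

Theorem corner_contravariantly_finite :
  contravariantly_finite (fin_projdim B) ->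
  contravariantly_finite (fin_projdim A).
Proof.
move=> cfB M fgM.
have [X [phi [/fin_projdimP[fgX [n pX]] phiP]]] := cfB _ (cut_fg he tri fgM).
have fgY : finitely_generated (pullback phi).
  apply: (fg_submodule fdA (i := ker_incl _)); first exact: val_inj.
  by apply: fg_prod => //; exact: inflate_fg.
exists (pullback phi), (snd \o ker_incl _); split.
  apply/(fin_projdim_cut fgY)/fin_projdimP; split; first exact: cut_fg.
  have [r rK Kr] := pullback_fst_bij phi.
  have lr : linear r.
    move=> a x y; apply: (can_inj rK).
    by rewrite pullback_fst_linear !Kr.
  exists n; apply: (@pd_le_iso _ _ _ _ (lin_of lr)) pX.
  by exists (pullback_fst (phi := phi)).
move=> Z f fpdZ; have fgZ : finitely_generated Z by case: fpdZ.
have [k kE] := phiP _ (cut_map he f) ((fin_projdim_cut fgZ).1 fpdZ).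
pose u : {linear Z -> inflate tri X} := inflate_map tri k \o cut_unit he tri Z.
have luf : linear (fun z => (u z, f z)).
  by move=> a x y; apply/pair_equal_spec; split; exact: linearP.
have fu z : pullback_map phi (lin_of luf z) = 0.
  rewrite /=; apply/eqP; rewrite subr_eq0; apply/eqP.
  rewrite -kE; apply/val_inj => /=.
  by rewrite linearZ.
by exists (ker_lift fu).
Qed.
End CornerApproximation.

(** * Quivers *)

Section QuotientMorphism.
Context (R : pzRingType) (I : ideal R).

Fact quot_proj_zmod_morphism : zmod_morphism (quot_proj I).
Proof.
have D := @quot_projD R I; move=> x y; apply: (canRL (addrK _)).
by rewrite -D subrK.
Qed.

Fact quot_proj_monoid_morphism : monoid_morphism (quot_proj I).
Proof. by split=> // x y; exact: quot_projM. Qed.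

HB.instance Definition _ := GRing.isZmodMorphism.Build R (quot_ring I)
  (quot_proj I) quot_proj_zmod_morphism.
HB.instance Definition _ := GRing.isMonoidMorphism.Build R (quot_ring I)
  (quot_proj I) quot_proj_monoid_morphism.

Lemma quot_proj_central z : (forall x, z * x = x * z) ->
  forall a, quot_proj I z * a = a * quot_proj I z.
Proof. by move=> zC a; rewrite -[a]quot_projK -!rmorphM zC. Qed.
End QuotientMorphism.

Section Quivers.
Context (Q : quiver).
Implicit Types (v w : vertex Q) (p : qpath Q) (S : {set vertex Q}).

Definition successor_closed S : Prop :=
  forall a : arrow Q, asource a \in S -> atarget a \in S.

Lemma successor_closed_path S p : successor_closed S ->
  psource p \in S -> ptarget p \in S.
Proof.
move=> clS; rewrite /ptarget /psource /parrows; case: p => -[v s] /= ws vS.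
elim: s v ws vS => //= a s IH v /andP[/eqP av ws] vS.
by apply: IH ws _; apply: clS; rewrite av.
Qed.

Lemma pcons (a : arrow Q) p : psource p = atarget a ->
  exists q, [/\ psource q = asource a, ptarget q = ptarget p
              & plength q = (plength p).+1].
Proof.
case: p => -[v s] ws; rewrite /psource /= => vE.
have wq : walk (asource a) (a :: s) by rewrite /= eqxx -vE.
exists (@QPath Q (asource a, a :: s) wq); split=> //.
by rewrite /ptarget /psource /parrows /= vE.
Qed.

Definition precyclic_set : {set vertex Q} := [set v | `[< precyclic v >]].

Lemma non_precyclic_closed : successor_closed (~: precyclic_set).
Proof.
move=> a; rewrite !inE => /asboolPn ns; apply/asboolPn => -[q [qs qc]].
have [r [rs rt _]] := pcons qs.
by apply: ns; exists r; rewrite rt.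
Qed.

Definition reach v : {set vertex Q} :=
  [set w | `[< exists p, psource p = v /\ ptarget p = w >]].

(** Take v in S reaching the most vertices. The origin of an arrow from S into v would reach all
    that v reaches, and also itself, which v cannot reach without closing a cycle. *)
Lemma exists_source S : S != set0 ->
  (forall v, v \in S -> ~ precyclic v) ->
  exists2 v, v \in S &
    forall a : arrow Q, asource a \in S -> atarget a != v.
Proof.
move=> /set0Pn[v0 v0S] npS.
have [v vS vmax] := @arg_maxnP _ v0 (mem S) (fun v => #|reach v|) v0S.
exists v => // a aS; apply/eqP => av; have := vmax _ aS.
rewrite /= leqNgt => /negP; apply; apply/proper_card/properP; split.
  apply/subsetP => w; rewrite !inE => /asboolP[p [ps pw]]; apply/asboolP.
  have [|q [qs qt _]] := @pcons a p; first by rewrite ps av.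
  by exists q; rewrite qt.
exists (asource a); rewrite inE.
  by apply/asboolP; exists (trivial_path (asource a)).
apply/asboolP => -[p [ps pt]]; have [|q [qs qt ql]] := @pcons a p.
  by rewrite ps av.
apply: (npS _ aS); exists (trivial_path (asource a)); split=> //.
by exists q; rewrite ql qt.
Qed.

Definition short_paths m : seq (qpath Q) :=
  flatten [seq pmap insub [seq (v, val t) | v <- enum (vertex Q),
                                            t <- enum {: k.-tuple (arrow Q)}]
          | k <- iota 0 m].

Lemma mem_short_paths m p : (plength p < m)%N -> p \in short_paths m.
Proof.
move=> pm; apply/flatten_mapP; exists (plength p); first by rewrite mem_iota.
rewrite mem_pmap_sub; apply/allpairsP.
exists (psource p, in_tuple (parrows p)); rewrite !mem_enum; split=> //.
exact: surjective_pairing.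
Qed.
End Quivers.

(** * Path algebras modulo relations *)

Section PathAlgebraQuotient.
Context (K : fieldType) (Q : quiver).
Local Notation KQ := (path_alg K Q).
Implicit Types (v w : vertex Q) (p q : qpath Q) (S : {set vertex Q}).

Definition path_elt p : KQ := << p >>.

Lemma monomial_mul (c d : K) p q :
  (<< c *g p >> : KQ) * << d *g q >> = opath (c * d) (Defs.pcomp p q).
Proof. exact: pa_mulUU. Qed.

(** This is c times the unit; it provides the central ring morphism from K through which KQ and its
    quotients are K-algebras. *)
Definition pa_scalar (c : K) : KQ := \sum_v << c *g trivial_path v >>.

Lemma scalar_mul_monomial c d p :
  pa_scalar c * (<< d *g p >> : KQ) = << c * d *g p >>.
Proof.
rewrite /pa_scalar mulr_suml (bigD1 (ptarget p)) //= big1 => [|v /negPf vp].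
  by rewrite monomial_mul pcomp1p eqxx addr0.
by rewrite monomial_mul pcomp1p eq_sym vp.
Qed.

Lemma monomial_mul_scalar c d p :
  (<< d *g p >> : KQ) * pa_scalar c = << c * d *g p >>.
Proof.
rewrite /pa_scalar mulr_sumr (bigD1 (psource p)) //= big1 => [|v /negPf vp].
  by rewrite monomial_mul pcompp1 eqxx addr0 mulrC.
by rewrite monomial_mul pcompp1 vp.
Qed.

Lemma scalarC c (x : KQ) : pa_scalar c * x = x * pa_scalar c.
Proof.
rewrite [x]monalgE mulr_sumr mulr_suml; apply/eq_bigr => p _.
by rewrite scalar_mul_monomial monomial_mul_scalar.
Qed.

Fact scalar_zmod_morphism : zmod_morphism pa_scalar.
Proof.
move=> c d; rewrite -sumrB; apply/eq_bigr => v _.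
by rewrite monalgUB.
Qed.

Fact scalar_monoid_morphism : monoid_morphism pa_scalar.
Proof.
split=> // c d; rewrite [pa_scalar d]/pa_scalar mulr_sumr; apply/eq_bigr => v _.
by rewrite scalar_mul_monomial.
Qed.

HB.instance Definition _ := GRing.isZmodMorphism.Build K KQ
  pa_scalar scalar_zmod_morphism.
HB.instance Definition _ := GRing.isMonoidMorphism.Build K KQ
  pa_scalar scalar_monoid_morphism.

Definition vertex_sum S : KQ := \sum_(v in S) vertex_elt K v.

Lemma vertex_sum_mul S c p :
  vertex_sum S * (<< c *g p >> : KQ) =
    if ptarget p \in S then << c *g p >> else 0.
Proof.
have vp v : vertex_elt K v * (<< c *g p >> : KQ) =
    if ptarget p == v then << c *g p >> else 0.
  by rewrite monomial_mul pcomp1p mul1r; case: eqP.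
rewrite /vertex_sum mulr_suml; under eq_bigr => v _ do rewrite vp.
case: ifPn => pS; last first.
  by rewrite big1 // => v vS; case: eqP pS => // ->; rewrite vS.
rewrite (bigD1 (ptarget p)) //= eqxx big1 ?addr0 // => v /andP[_ /negPf].
by rewrite eq_sym => ->.
Qed.

Lemma mul_vertex_sum S c p :
  (<< c *g p >> : KQ) * vertex_sum S =
    if psource p \in S then << c *g p >> else 0.
Proof.
have vp v : (<< c *g p >> : KQ) * vertex_elt K v =
    if psource p == v then << c *g p >> else 0.
  by rewrite monomial_mul pcompp1 mulr1 eq_sym; case: eqP.
rewrite /vertex_sum mulr_sumr; under eq_bigr => v _ do rewrite vp.
case: ifPn => pS; last first.
  by rewrite big1 // => v vS; case: eqP pS => // ->; rewrite vS.
rewrite (bigD1 (psource p)) //= eqxx big1 ?addr0 // => v /andP[_ /negPf].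
by rewrite eq_sym => ->.
Qed.

Lemma vertex_sumC S : vertex_sum S + vertex_sum (~: S) = 1.
Proof.
rewrite [RHS](bigID (mem S)) /=; congr (_ + _).
by apply: eq_bigl => v; rewrite inE.
Qed.

Lemma vertex_sum_idem S : vertex_sum S * vertex_sum S = vertex_sum S.
Proof.
rewrite {2 3}/vertex_sum mulr_sumr; apply/eq_bigr => v vS.
by rewrite vertex_sum_mul /ptarget /= vS.
Qed.

Lemma path_alg_ind (P : KQ -> Prop) : P 0 ->
  (forall x y, P x -> P y -> P (x + y)) ->
  (forall c p, P << c *g p >>) -> forall x, P x.
Proof. by move=> P0 PD PU x; rewrite [x]monalgE; elim/big_ind: _. Qed.

Lemma sandwichE (a b x : KQ) :
  a * x * b = \sum_(p <- msupp x) a * (<< x@_p *g p >> : KQ) * b.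
Proof. by rewrite {1}[x]monalgE mulr_sumr mulr_suml. Qed.

Lemma vertex_sum_corner S (T : {set vertex Q}) (x : KQ) :
  (forall p, psource p \in S -> ptarget p \in T -> False) ->
  vertex_sum T * x * vertex_sum S = 0.
Proof.
move=> ST; rewrite sandwichE big1 // => p _.
rewrite vertex_sum_mul; case: ifPn => pT; last by rewrite mul0r.
rewrite mul_vertex_sum; case: ifPn => // pS.
by case: (ST p).
Qed.

(** The last arrow of the path splits off as the left factor, since paths compose from right to
    left. *)
Lemma path_in_arrow_ideal_exp m p :
  (m <= plength p)%N -> ideal_exp (@arrow_ideal K Q) m (path_elt p).
Proof.
elim: m p => [//|m IH] -[[v s] ws]; rewrite /plength /parrows /=.
case: (lastP s) ws => [//|{}s a]; rewrite size_rcons /= => ws ms J [_ _ _ _] SJ.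
have [wsl /eqP sa] : walk v s /\ asource a == walk_end v s.
  by move: ws; rewrite -cats1 walk_cat /= andbT => /andP[].
apply: SJ; exists (arrow_elt K a).
  by move=> J' _; apply; exists a.
exists (path_elt (@QPath Q (v, s) wsl)).
  by apply: IH.
rewrite monomial_mul mulr1; set q := @QPath Q (v, s) wsl.
have := pcompP (arrow_path a) q.
case: (Defs.pcomp _ _) => [r [_ rs ra]|]; last first.
  by rewrite /ptarget /psource /parrows /= sa eqxx.
suff -> : r = @QPath Q (v, rcons s a) ws by [].
apply/val_inj; rewrite [LHS]surjective_pairing.
by rewrite -/(psource r) -/(parrows r) rs ra cats1.
Qed.

Lemma scalar_mul_vertex c v :
  pa_scalar c * vertex_sum [set v] = << c *g trivial_path v >>.
Proof.
have -> : vertex_sum [set v] = vertex_elt K v by exact: big_set1.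
by rewrite scalar_mul_monomial mulr1.
Qed.

(** A path starting in v stays in S, so it survives only if it ends in v, and then it is trivial.
    The scalar is the coefficient of x at the trivial path. *)
Lemma source_corner S v (x : KQ) : v \in S -> successor_closed S ->
  (forall p, psource p = v -> ptarget p = v -> p = trivial_path v) ->
  exists c, vertex_sum (~: (S :\ v)) * x * vertex_sum [set v] =
            pa_scalar c * vertex_sum [set v].
Proof.
move=> vS clS triv; exists (x@_(trivial_path v)).
rewrite [RHS]scalar_mul_vertex [LHS]sandwichE.
have term p :
    vertex_sum (~: (S :\ v)) * (<< x@_p *g p >> : KQ) * vertex_sum [set v] =
    if p == trivial_path v then << x@_p *g p >> else 0.
  rewrite vertex_sum_mul !inE; case: (eqVneq (ptarget p) v) => /= [pt|ptv].
    rewrite mul_vertex_sum inE; case: (eqVneq p (trivial_path v)) => [->|pv].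
      by rewrite eqxx.
    case: eqVneq => // ps; by rewrite (triv p ps pt) eqxx in pv.
  case: (eqVneq p (trivial_path v)) => [pE|_]; first by rewrite pE eqxx in ptv.
  case: ifPn => pS; last by rewrite mul0r.
  rewrite mul_vertex_sum inE; case: eqVneq => // ps.
  by case/negP: pS; apply: successor_closed_path; rewrite ?ps.
under eq_bigr => p _ do rewrite term.
rewrite -big_mkcond /=; have [vx|vx] := boolP (trivial_path v \in msupp x).
  by rewrite (big_rem _ vx) /= eqxx big1_seq ?addr0 // => p /andP[/eqP->];
    rewrite mem_rem_uniqF ?fset_uniq.
rewrite big1_seq => [|p /andP[/eqP-> pv]]; last by rewrite pv in vx.
by rewrite mcoeff_outdom // monalgU0.
Qed.

Section Quotient.
Context (I : ideal KQ).
Local Notation Lambda := (quot_ring I).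
Local Notation pi := (quot_proj I).

Context (iota : {rmorphism K -> Lambda}).
Hypothesis iotaE : forall c, iota c = pi (pa_scalar c).

Lemma quotient_scalarC c (a : Lambda) : iota c * a = a * iota c.
Proof. by rewrite iotaE; exact: quot_proj_central (scalarC c) a. Qed.

Lemma quotient_scalar_mul c p : iota c * pi (path_elt p) = pi << c *g p >>.
Proof. by rewrite iotaE -[LHS]quot_projM scalar_mul_monomial mulr1. Qed.

(** Paths of length at least m vanish modulo I by admissibility, so the finitely many shorter ones
    span. *)
Lemma quotient_finite_dim : admissible (ideal_set I) ->
  exists n (g : 'I_n -> Lambda),
    forall a, exists c : 'I_n -> K, a = \sum_i iota (c i) * g i.
Proof.
move=> [_ [m _ mI]]; pose s := undup (short_paths Q m).
exists (size s), (fun i => pi (path_elt (tnth (in_tuple s) i))) => a.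
rewrite -[a]quot_projK; elim/path_alg_ind: (repr a) => [|x y|c p].
- exists (fun=> 0); rewrite (rmorph0 pi) big1 // => i _.
  by rewrite rmorph0 mul0r.
- move=> [c cE] [d dE]; exists (fun i => c i + d i).
  rewrite quot_projD cE dE -big_split; apply/eq_bigr => i _.
  by rewrite rmorphD mulrDl.
have [ps|ps] := boolP (p \in s).
  have ip : (index p s < size s)%N by rewrite index_mem.
  exists (fun i => if i == Ordinal ip then c else 0).
  rewrite (bigD1 (Ordinal ip)) //= big1 => [|i /negPf ->]; last first.
    by rewrite rmorph0 mul0r.
  by rewrite eqxx addr0 (tnth_nth p) /= nth_index // quotient_scalar_mul.
exists (fun=> 0); rewrite big1 => [|i _]; last by rewrite rmorph0 mul0r.
rewrite -(rmorph0 pi); apply/quot_projE; rewrite subr0.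
have -> : << c *g p >> = pa_scalar c * path_elt p.
  by rewrite scalar_mul_monomial mulr1.
have [_ _ IM _] := idealP I; apply: IM; apply: mI.
apply: path_in_arrow_ideal_exp; rewrite leqNgt; apply: contra ps => pm.
by rewrite mem_undup mem_short_paths.
Qed.
End Quotient.
End PathAlgebraQuotient.

(** * The non-precyclic part *)

Section AcyclicPart.
Context (K : fieldType) (Q : quiver) (I : ideal (path_alg K Q)).
Hypothesis hI : admissible (ideal_set I).
Local Notation Lambda := (quot_ring I).
Implicit Types (S : {set vertex Q}).

Definition qvertex_sum S : Lambda := quot_proj I (vertex_sum K S).

Lemma qvertex_sumC S : qvertex_sum S + qvertex_sum (~: S) = 1.
Proof. by rewrite -quot_projD vertex_sumC. Qed.

Lemma qvertex_sum_idem S : qvertex_sum S * qvertex_sum S = qvertex_sum S.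
Proof. by rewrite -[LHS]quot_projM vertex_sum_idem. Qed.

Lemma qvertex_sum1 v S : v \in S ->
  qvertex_sum (~: (S :\ v)) = qvertex_sum (~: S) + qvertex_sum [set v].
Proof.
move=> vS; rewrite -quot_projD; congr (quot_proj I _).
rewrite /vertex_sum (bigD1 v) /=; last by rewrite !inE eqxx.
rewrite big_set1 addrC; congr (_ + _); apply: eq_bigl => w.
by rewrite !inE negb_and negbK; case: eqVneq => [->|] /=; rewrite ?vS ?andbT.
Qed.

Lemma qvertex_sum_corner S : successor_closed S ->
  forall a, qvertex_sum (~: S) * a * qvertex_sum S = 0.
Proof.
move=> clS a; rewrite -[a]quot_projK.
rewrite -[_ * quot_proj _ _]quot_projM -[LHS]quot_projM.
rewrite vertex_sum_corner ?rmorph0 //.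
by move=> p pS; rewrite inE (successor_closed_path clS pS).
Qed.

Context (iota : {rmorphism K -> Lambda}).
Hypothesis iotaE : forall c, iota c = quot_proj I (pa_scalar Q c).

Lemma qsource_corner S v a : v \in S -> successor_closed S ->
  ~ precyclic v ->
  exists c, qvertex_sum (~: (S :\ v)) * a * qvertex_sum [set v] =
            iota c * qvertex_sum [set v].
Proof.
move=> vS clS npv.
have [|c cE] := @source_corner K Q S v (repr a) vS clS.
  move=> p ps pt; case: (posnP (plength p)) => [p0|p_gt0].
    apply/val_inj; rewrite [LHS]surjective_pairing.
    by rewrite -/(psource p) -/(parrows p) ps (size0nil p0).
  by case: npv; exists (trivial_path v); split=> //; exists p.
exists c; rewrite iotaE -[RHS]quot_projM -cE.
by rewrite [RHS]quot_projM [X in quot_mul X _]quot_projM quot_projK.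
Qed.

Let fdL := quotient_finite_dim iotaE hI.
Let iotaC := quotient_scalarC iotaE.

(** Induction on the size of S. For a source v of S, the set S minus v is again successor-closed,
    and Z is covered so that the kernel is supported on it. *)
Lemma acyclic_fpd S (Z : lmodType Lambda) : successor_closed S ->
  (forall v, v \in S -> ~ precyclic v) -> finitely_generated Z ->
  (forall x : Z, qvertex_sum (~: S) *: x = 0) -> exists n, pd_le n Z.
Proof.
move: {2}#|S| (erefl #|S|) => n nS.
elim: n S nS Z => [|n IH] S nS Z clS npS fgZ SZ.
  have Z0 (x : Z) : x = 0.
    rewrite -[x]scale1r -(qvertex_sumC S) scalerDl SZ addr0.
    by rewrite (cards0_eq nS) /qvertex_sum /vertex_sum big_set0 rmorph0 scale0r.
  exists 0%N; apply: (@projective_retract _ 'rV_0 _ \0 \0).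
    by move=> x; rewrite [x]Z0 linear0.
  exact: projective_free.
have [|v vS vsrc] := @exists_source Q S _ npS.
  by rewrite -card_gt0 nS.
have clS' : successor_closed (S :\ v).
  by move=> a; rewrite !inE => /andP[_ aS]; rewrite (vsrc _ aS) (clS _ aS).
have gv (x : Z) : qvertex_sum (~: (S :\ v)) *: x = qvertex_sum [set v] *: x.
  by rewrite (qvertex_sum1 vS) scalerDl SZ add0r.
(* Take a K-basis u of e_v Z; with E = e_v times the identity matrix it yields the map from k copies
   of Lambda e_v to Z. *)
have [k0 [b bE]] := fg_kspan fdL fgZ.
have sU : subspace iota (fun x : Z => qvertex_sum [set v] *: x = x).
  split; first exact: scaler0.
  by move=> c x y xE yE; rewrite scalerDr yE scalerA -iotaC -scalerA xE.
have [k [u [Uu uU ufree]]] := subspace_basis sU (fun x _ => bE x).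
pose E : 'M[Lambda]_k := (qvertex_sum [set v])%:M.
have mulE (x : 'rV[Lambda]_k) i : (x *m E) 0 i = x 0 i * qvertex_sum [set v].
  rewrite mxE (bigD1 i) //= mxE eqxx mulr1n big1 ?addr0 // => j /negPf ij.
  by rewrite mxE ij mulr0n mulr0.
apply: (@fpd_of_cover _ _ _ fdL iotaC (qvertex_sum (S :\ v))
  (qvertex_sum (~: (S :\ v))) _ _ _ _ Z k u E) => //.
- exact: qvertex_sum_idem.
- by rewrite addrC qvertex_sumC.
- exact: qvertex_sum_corner.
- move=> Y; apply: IH => //; last by move=> w /setD1P[_ /npS].
  by move: nS; rewrite (cardsD1 v) vS => -[].
- by rewrite -scalar_mxM qvertex_sum_idem.
- move=> j; rewrite (bigD1 j) //= mxE eqxx mulr1n Uu.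
  rewrite big1 ?addr0 // => i /negPf ij.
  by rewrite mxE eq_sym ij mulr0n scale0r.
- move=> x; have /uU[c cE] : qvertex_sum [set v] *: (qvertex_sum [set v] *: x) =
      qvertex_sum [set v] *: x by rewrite scalerA qvertex_sum_idem.
  by exists (iota \o c); rewrite gv.
move=> x xE ux gx.
(* The entries of x lie in g Lambda e_v = K e_v, so the image of x is a K-combination of the basis u
   and vanishes only if x does. *)
have /choice[c cE] i : exists c, x 0 i = iota c * qvertex_sum [set v].
  have [c cE] := qsource_corner (x 0 i) vS clS (npS v vS); exists c.
  have gxi : qvertex_sum (~: (S :\ v)) * x 0 i = x 0 i.
    by have := congr1 (fun y : 'rV_k => y 0 i) gx; rewrite mxE.
  by rewrite -cE gxi -mulE xE.
apply/rowP => i; rewrite cE mxE (ufree c) ?rmorph0 ?mul0r // -[RHS]ux.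
by apply/eq_bigr => j _; rewrite cE -scalerA Uu.
Qed.
End AcyclicPart.

Theorem proposition6p1 (K : fieldType) (Q : quiver) (I : ideal (path_alg K Q))
    (hI : admissible (ideal_set I)) :
  let Lambda : pzRingType := quot_ring I in
  let eLe : pzRingType := corner (precyclic_idemP I) in
  (is_lfindim eLe 0 -> contravariantly_finite (fin_projdim eLe)) /\
  (contravariantly_finite (fin_projdim eLe) ->
   contravariantly_finite (fin_projdim Lambda)).
Proof.
move=> Lambda eLe; split; first exact: lfindim0_contravariantly_finite.
pose iota : {rmorphism K -> Lambda} := quot_proj I \o @pa_scalar K Q.
have iotaE c : iota c = quot_proj I (pa_scalar Q c) by [].
have eE : precyclic_idem I = qvertex_sum I (precyclic_set Q).
  congr (quot_proj I _); apply: eq_bigl => v.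
  by rewrite inE.
have clN := @non_precyclic_closed Q.
apply: (corner_contravariantly_finite (quotient_finite_dim iotaE hI)
  (quotient_scalarC iotaE)).
  (* Here ea = eae + ea(1 - e), and the last term is 0 by successor-closedness of the non-precyclic
     vertices. *)
  move=> a; rewrite eE -[RHS]mulr1 -(qvertex_sumC I (precyclic_set Q)) mulrDr.
  by have := qvertex_sum_corner clN a; rewrite setCK => ->; rewrite addr0.
move=> Z fgZ eZ; apply: (acyclic_fpd hI iotaE clN) => //.
  by move=> v; rewrite !inE => /asboolPn.
by move=> x; rewrite setCK -eE; exact: eZ.
Qed.
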